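(* For any $b\ge2$, $i\in I$ and $n\ge2$, $$K_i(n)=c_{i,n}\,(b^{B(n)}+1)+K_{i-2c_{i,n}}(h_{i,n}),$$ and moreover $1\le c_{i,n}\le b-1$ and $0\le K_{i-2c_{i,n}}(h_{i,n})\le (b-1)B(n)-2$.
   Context: Fix a base $b\ge2$. For $v\in\mathbb{N}$, $s(v)$ is the sum of the base-$b$ digits of $v$, $f(v)=v+s(v)$, and $F(u)=|\{v\in\mathbb{N}: f(v)=u\}|$. $K(n)$ is the smallest $u\in\mathbb{N}$ with $F(u)=n$, and for $n\ge2$, $B(n)=\lfloor\log_b K(n)\rfloor$. The index set $I$ is the set of residue classes modulo $b-1$ if $b$ is even, and the set of even residue classes $\{0,2,\dots,b-3\}$ modulo $b-1$ if $b$ is odd; subscripts are read modulo $b-1$. For $i\in I$, $K_i(n)$ is the smallest $u\in\mathbb{N}$ with $F(u)=n$ and $u\equiv i\pmod{b-1}$. For $n\ge2$ and $i\in I$ define $$K'_i(n)=\min\{K_i(\lceil n/2\rceil)+K_{-i-2}(\lfloor n/2\rfloor),\ K_i(\lfloor n/2\rfloor)+K_{-i-2}(\lceil n/2\rceil)\}.$$ Let $c_{i,n}$ be the smallest integer $c\ge1$ such that $K'_{i-2c}(n)=\min_{j\in I}K'_j(n)$. Let $h_{i,n}=\lceil n/2\rceil$ if $$K_{i-2c_{i,n}}(\lceil n/2\rceil)+K_{2c_{i,n}-i-2}(\lfloor n/2\rfloor)<K_{i-2c_{i,n}}(\lfloor n/2\rfloor)+K_{2c_{i,n}-i-2}(\lceil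 n/2\rceil),$$ and $h_{i,n}=\lfloor n/2\rfloor$ otherwise. *)

(* Defs.v *)
From HB Require Import structures.
From mathcomp Require Import all_boot all_order all_algebra.
From mathcomp Require Import boolp.

Set Implicit Arguments.
Unset Strict Implicit.
Unset Printing Implicit Defensive.

Import Order.TTheory GRing.Theory Num.Theory.

Local Open Scope nat_scope.

(* The least element of P; the value is 0 when P is empty, which for the
   predicates below never happens at the arguments considered. *)
Definition least (P : pred nat) : nat :=
  if pselect (exists m, P m) is left exP then ex_minn exP else 0.

(* For b >= 2 we have v < b ^ v, so that v has at most v digits. *)
Definition digit_sum (b v : nat) : nat := \sum_(k < v) (v %/ b ^ k) %% b.

Definition f (b v : nat) : nat := v + digit_sum b v.

(* As v <= f b v, every v with f b v = u is at most u. *)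
Definition F (b u : nat) : nat := #|[set v : 'I_u.+1 | f b v == u]|.

Definition K (b n : nat) : nat := least (fun u => F b u == n).

Definition B (b n : nat) : nat := trunc_log b (K b n).

(* The ordinal j stands for the class of j modulo b - 1. *)
Definition index_set (b : nat) : {set 'I_(b - 1)} :=
  [set j : 'I_(b - 1) | odd b ==> ~~ odd j].

(* Subscripts are integers and only matter modulo b - 1; for b = 2 the modulus
   is 1 and the congruence always holds. *)
Definition Kres (b : nat) (i : int) (n : nat) : nat :=
  least (fun u => (F b u == n) && (u%:Z == i %[mod (b - 1)%N%:Z])%Z).

Definition Kres' (b : nat) (i : int) (n : nat) : nat :=
  minn (Kres b i (uphalf n) + Kres b (- i - 2)%R n./2)
       (Kres b i n./2 + Kres b (- i - 2)%R (uphalf n)).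

(* The class 0 always belongs to index_set b, so taking its value as the
   default of the iterated minimum does not affect the result. *)
Definition minKres' (b n : nat) : nat :=
  \big[minn/Kres' b 0 n]_(j in index_set b) Kres' b j n.

Definition c (b : nat) (i : int) (n : nat) : nat :=
  least (fun m => (1 <= m) && (Kres' b (i - 2 * m%:Z)%R n == minKres' b n)).

Definition h (b : nat) (i : int) (n : nat) : nat :=
  let m := (c b i n)%:Z%R in
  if Kres b (i - 2 * m)%R (uphalf n) + Kres b (2 * m - i - 2)%R n./2
     < Kres b (i - 2 * m)%R n./2 + Kres b (2 * m - i - 2)%R (uphalf n)
  then uphalf n else n./2.

(* Main.v *)
(* Split v < b^(m+1) as v = d b^m + r, so that f(v) = d (b^m + 1) + f(r). For
   b^m <= u < b^(m+1) with u = c (b^m + 1) + w only d = c and d = c - 1 can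
   contribute, and the digit complement r -> b^m - 1 - r turns the second
   contribution into F(y), where w + y = (b - 1) m - 2. So F(u) = F(w) + F(y),
   unless F(u) is already a value of F below b^m. The least u with F(u) = n thus
   comes from the least m admitting F(w) + F(y) = n with w + y = (b - 1) m - 2.
   By strong induction on n, K_i(p) < b^(B(p)+1) and B is strictly increasing,
   and some x, y with F(x) = F(y) = p and x + y = -2 mod b - 1 have a sum below
   every number with more than p preimages under f. Unbalanced splits of n are
   therefore more expensive than balanced ones, which gives (b - 1) B(n) - 2 =
   min_j K'_j(n); minimality of c and then of w singles out K_i(n). *)
Require Import Defs.
From HB Require Import structures.
From mathcomp Require Import all_boot all_order all_algebra.
From mathcomp Require Import boolp.
From mathcomp Require Import zify ring.

Set Implicit Arguments.
Unset Strict Implicit.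
Unset Printing Implicit Defensive.

Import Order.TTheory GRing.Theory Num.Theory.

Local Open Scope nat_scope.

(** * Digit sums: recursion, leading digit, complement *)

Lemma digit_sum_widen b v N : 2 <= b -> v <= N ->
  digit_sum b v = \sum_(k < N) (v %/ b ^ k) %% b.
Proof.
move=> hb vN; rewrite /digit_sum -!(big_mkord xpredT (fun k => (v %/ b ^ k) %% b)).
rewrite (big_cat_nat (leq0n _) vN) /= [X in _ = _ + X]big1_seq ?addn0 // => k.
rewrite mem_index_iota => /andP[_ /andP[vk _]].
by rewrite divn_small ?mod0n //; apply: leq_ltn_trans vk (ltn_expl _ hb).
Qed.

Lemma digit_sum_recl b v : 2 <= b ->
  digit_sum b v = v %% b + digit_sum b (v %/ b).
Proof.
move=> hb; rewrite (digit_sum_widen hb (leqnSn v)) big_ord_recl /= divn1.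
congr (_ + _); rewrite (@digit_sum_widen b _ v) ?leq_div //.
by apply: eq_bigr => k _; rewrite -divnMA -expnS.
Qed.

Lemma digit_sum_small b v : v < b -> digit_sum b v = v.
Proof.
case: v => [|v] vb; first by rewrite /digit_sum big_ord0.
rewrite digit_sum_recl; last lia.
by rewrite modn_small // divn_small // /digit_sum big_ord0 addn0.
Qed.

Lemma digit_sum_split b m d r : 2 <= b -> d < b -> r < b ^ m ->
  digit_sum b (d * b ^ m + r) = d + digit_sum b r.
Proof.
move=> hb db; elim: m r => [|m IH] r rb.
  have -> : r = 0 by rewrite expn0 in rb; lia.
  by rewrite expn0 muln1 addn0 digit_sum_small // /digit_sum big_ord0 addn0.
have b0 : 0 < b by lia.
rewrite digit_sum_recl // expnSr mulnA modnMDl divnMDl // IH.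
  by rewrite (@digit_sum_recl b r) //; lia.
by rewrite ltn_divLR // -expnSr.
Qed.

Lemma digit_sum_le b m r : 2 <= b -> r < b ^ m -> digit_sum b r <= (b - 1) * m.
Proof.
move=> hb; elim: m r => [|m IH] r rb.
  by have -> : r = 0 by [rewrite expn0 in rb; lia]; rewrite /digit_sum big_ord0.
have b0 : 0 < b by lia.
rewrite digit_sum_recl // mulnS leq_add //; first by have := ltn_pmod r b0; lia.
by apply: IH; rewrite ltn_divLR // -expnSr.
Qed.

(** All digits of [b ^ m - 1] are [b - 1], so subtracting [r] causes no borrow and turns each digit
    [d] into [b - 1 - d]. *)
Lemma digit_sum_compl b m r : 2 <= b -> r < b ^ m ->
  digit_sum b (b ^ m - 1 - r) + digit_sum b r = (b - 1) * m.
Proof.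
move=> hb; elim: m r => [|m IH] r rb.
  by have -> : r = 0 by [rewrite expn0 in rb; lia]; rewrite /digit_sum big_ord0 muln0.
have b0 : 0 < b by lia.
have qb : r %/ b < b ^ m by rewrite ltn_divLR // -expnSr.
have sb := ltn_pmod r b0.
have E : b ^ m.+1 - 1 - r = (b ^ m - 1 - r %/ b) * b + (b - 1 - r %% b).
  have [e Ee] : exists e, b ^ m = r %/ b + 1 + e by exists (b ^ m - 1 - r %/ b); lia.
  have [g Eg] : exists g, b = r %% b + 1 + g by exists (b - 1 - r %% b); lia.
  have Er := divn_eq r b; rewrite expnSr Ee.
  have -> : r %/ b + 1 + e - 1 - r %/ b = e by lia.
  have -> : b - 1 - r %% b = g by lia.
  by rewrite !mulnDl mul1n; lia.
rewrite E digit_sum_recl // modnMDl divnMDl // (@modn_small (b - 1 - _)); last lia.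
rewrite (@divn_small (b - 1 - _)) ?addn0; last lia.
by rewrite (@digit_sum_recl b r) // mulnS -(IH _ qb); lia.
Qed.

(** * Counting preimages below a power of the base *)

Definition count_below b N u := \sum_(v < N) (f b v == u).

Lemma count_below_widen b N u : u < N -> count_below b N u = F b u.
Proof.
move=> uN; rewrite /F cardsE -sum1_card big_mkcond /=.
rewrite [RHS](_ : _ = count_below b u.+1 u); last first.
  by apply: eq_bigr => v _; rewrite unfold_in -/(_ == _); case: (_ == _).
rewrite /count_below -!(big_mkord xpredT (fun v => (f b v == u) : nat)).
rewrite (big_cat_nat (leq0n _) uN) /= [X in _ + X]big1_seq ?addn0 // => v.
rewrite mem_index_iota => /andP[_ /andP[uv _]].
by case: eqP => // E; have := leq_addr (digit_sum b v) v; rewrite -/(f b v) E; lia.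
Qed.

Lemma count_below_gt b m u : 2 <= b -> b ^ m + (b - 1) * m <= u ->
  count_below b (b ^ m) u = 0.
Proof.
move=> hb hu; apply: big1 => v _; case: eqP => // E.
by have := digit_sum_le hb (ltn_ord v); move: (ltn_ord v) E; rewrite /f; lia.
Qed.

(** The complement [v -> b ^ m - 1 - v] sends [f b v] to [b ^ m - 1 + (b - 1) * m - f b v]. *)
Lemma count_below_sym b m x y : 2 <= b -> x + y + 1 = b ^ m + (b - 1) * m ->
  count_below b (b ^ m) x = count_below b (b ^ m) y.
Proof.
move=> hb E; rewrite /count_below (reindex_inj rev_ord_inj) /=.
apply: eq_bigr => v _; congr nat_of_bool.
have vb := ltn_ord v; have C := digit_sum_compl hb vb.
have -> : b ^ m - v.+1 = b ^ m - 1 - v by lia.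
by rewrite /f; apply/eqP/eqP; lia.
Qed.

Lemma count_below_split b m u : 2 <= b ->
  count_below b (b ^ m.+1) u =
  \sum_(d < b) \sum_(r < b ^ m) (d * (b ^ m + 1) + f b r == u).
Proof.
move=> hb; rewrite /count_below -(big_mkord xpredT (fun v => (f b v == u) : nat)).
rewrite expnS big_nat_mul big_mkord; apply: eq_bigr => d _.
rewrite -{1}[(d * b ^ m)%N]add0n big_addn mulSn addnK big_mkord.
apply: eq_bigr => r _; rewrite /f (addnC (r : nat)) digit_sum_split //.
by congr nat_of_bool; apply/eqP/eqP; rewrite mulnDr; lia.
Qed.

Lemma expn_gt_linear b m : 2 <= b -> (b - 1) * m < b ^ m.
Proof.
move=> hb; elim: m => [|m IH]; first by rewrite muln0.
rewrite expnS mulnS; move: IH; move: (b ^ m) => X; nia.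
Qed.

Lemma sum_ord_two b (G : nat -> nat) c : 0 < c < b ->
  (forall d, d < b -> d != c -> d != c.-1 -> G d = 0) ->
  \sum_(d < b) G d = G c + G c.-1.
Proof.
move=> /andP[c0 cb] G0.
have cb' : c.-1 < b by lia.
rewrite (bigD1 (Ordinal cb)) //= (bigD1 (Ordinal cb')) /=; last first.
  by rewrite -val_eqE /=; lia.
rewrite big1 ?addn0 // => d /andP[]; rewrite -!val_eqE /= => dc dc'.
exact: G0.
Qed.

(* Fixing the leading digit d of v < b ^ m.+1 leaves f b r = u - d * (b ^ m + 1)
   with r < b ^ m, which is solvable for at most two values of d. *)
Lemma F_leading_digit b m c w : 2 <= b -> 0 < c < b -> w <= b ^ m ->
  c * (b ^ m + 1) + w < b ^ m.+1 ->
  F b (c * (b ^ m + 1) + w) =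
  count_below b (b ^ m) w + count_below b (b ^ m) (w + b ^ m + 1).
Proof.
move=> hb hc hw hu; rewrite -(count_below_widen b hu) count_below_split //.
rewrite (@sum_ord_two _ (fun d => \sum_(r < b ^ m)
   (d * (b ^ m + 1) + f b r == c * (b ^ m + 1) + w)) c) //.
  congr (_ + _); apply: eq_bigr => r _; congr nat_of_bool; first by rewrite eqn_add2l.
  case: c hc hu => // c _ _ /=; rewrite mulSn -addnA (addnCA _ _ w) eqn_add2l.
  by congr (_ == _); lia.
move=> d db dc dc'; apply: big1 => r _; case: eqP => // E; exfalso.
have rb := ltn_ord r; have rs := digit_sum_le hb rb; have L := expn_gt_linear m hb.
move: E; rewrite /f; move: (digit_sum b r) rs rb => s; move: (nat_of_ord r) => r'.
move: L hw; move: (b ^ m) ((b - 1) * m) => X Y LY hw sY rX E.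
case: (ltngtP d c) => dc2; last by rewrite dc2 eqxx in dc.
  have {dc dc' dc2} [e Ee] : exists e, c = d + 2 + e by exists (c - d - 2); lia.
  by move: E; rewrite Ee; nia.
have [e Ee] : exists e, d = c + 1 + e by exists (d - c - 1); lia.
by move: E; rewrite Ee; nia.
Qed.

(** Digit [c] at [b ^ m] contributes [F b w]; digit [c - 1] contributes the count at
    [w + b ^ m + 1], whose mirror image is [y]. *)
Lemma F_join b m c w y : 2 <= b -> 0 < c < b -> w + y + 2 = (b - 1) * m ->
  c * (b ^ m + 1) + w < b ^ m.+1 ->
  F b (c * (b ^ m + 1) + w) = F b w + F b y.
Proof.
move=> hb hc hwy hu; have L := expn_gt_linear m hb.
rewrite F_leading_digit //; last lia.
rewrite count_below_widen; last lia.
congr (_ + _); rewrite -(@count_below_widen b (b ^ m) y); last lia.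
by apply: count_below_sym => //; lia.
Qed.

Lemma F_split b m u : 2 <= b -> b ^ m <= u < b ^ m.+1 -> 0 < F b u ->
  (exists2 x, x < b ^ m & F b x = F b u) \/
  exists c w y, [/\ 0 < c < b, w + y + 2 = (b - 1) * m,
    u = c * (b ^ m + 1) + w & F b u = F b w + F b y].
Proof.
move=> hb /andP[um uM] Fu; have L := expn_gt_linear m hb.
have small w : w <= b ^ m -> 0 < count_below b (b ^ m) w ->
    exists2 x, x < b ^ m & F b x = count_below b (b ^ m) w.
  rewrite leq_eqVlt => /predU1P[->|wm] C0; last by exists w; rewrite ?count_below_widen.
  have Y0 : 0 < (b - 1) * m.
    case: (posnP ((b - 1) * m)) => // Y0.
    by move: C0; rewrite count_below_gt // Y0; lia.
  (* The mirror image of [b ^ m] under [count_below_sym]. *)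
  exists ((b - 1) * m - 1); first lia.
  rewrite -(@count_below_widen b (b ^ m)); last lia.
  by apply: count_below_sym => //; lia.
have b0 : 0 < b ^ m + 1 by lia.
have E := divn_eq u (b ^ m + 1); have wm := ltn_pmod u b0.
move: (u %/ _) (u %% _) E wm => c w E wm; subst u.
have cb : c < b.
  by rewrite ltnNge; apply/negP => bc; move: uM; rewrite expnS; nia.
(* Quotient 0 means [u = b ^ m], and then only leading digit 0 contributes. *)
have [c0|c0] := posnP c.
  left; subst c; have -> : 0 * (b ^ m + 1) + w = b ^ m by lia.
  suff FC : F b (b ^ m) = count_below b (b ^ m) (b ^ m).
    rewrite FC; apply: small => //; rewrite -FC; move: Fu.
    by have -> : 0 * (b ^ m + 1) + w = b ^ m by lia.
  have uM' : b ^ m < b ^ m.+1 by rewrite ltn_exp2l.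
  rewrite -(count_below_widen b uM') count_below_split //.
  rewrite (bigD1 (Ordinal (ltnW hb))) //= [X in _ + X]big1 ?addn0 //= => d d0.
  apply: big1 => r _; case: eqP => //; rewrite -val_eqE /= in d0.
  by move: d0; case: (nat_of_ord d) => // d' _; nia.
have hc : 0 < c < b by rewrite c0.
have wm' : w <= b ^ m by lia.
have FE := F_leading_digit hb hc wm' uM.
(* For large [w] the number [w + b ^ m + 1] exceeds every [f b v] with [v < b ^ m], so one count is
   left, a value of [F] below [b ^ m]. *)
case: (ltnP (w + 1) ((b - 1) * m)) => hw; last first.
  rewrite (@count_below_gt _ m (w + b ^ m + 1)) ?addn0 in FE; [|by []|lia].
  by left; rewrite FE; apply: small => //; rewrite -FE.
right; exists c, w, ((b - 1) * m - 2 - w); split=> //; first lia.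
apply: F_join => //; lia.
Qed.

(** * Parity and residue classes modulo [b - 1] *)

Lemma odd_digit_sum b v : 2 <= b -> odd b -> odd (digit_sum b v) = odd v.
Proof.
move=> hb ob; elim/ltn_ind: v => v IH; case: (posnP v) => [->|v0].
  by rewrite /digit_sum big_ord0.
rewrite digit_sum_recl // oddD IH; last by rewrite ltn_Pdiv //; lia.
by rewrite {3}(divn_eq v b) oddD oddM ob andbT addbC.
Qed.

(** For odd [b], [v] and its digit sum have the same parity. This is why only even classes are
    indices. *)
Lemma F_gt0_even b u : 2 <= b -> odd b -> 0 < F b u -> ~~ odd u.
Proof.
move=> hb ob /card_gt0P[v]; rewrite inE => /eqP <-.
by rewrite /f oddD odd_digit_sum // addbb.
Qed.

Definition cong b (x y : int) := ((b - 1)%N%:Z %| (x - y)%R)%Z.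

(** Membership in the index set for integer subscripts: for odd [b] the modulus is even, so parity
    depends only on the class. *)
Definition valid b (i : int) := odd b ==> (2 %| i)%Z.

Arguments cong b%_nat_scope (x y)%_ring_scope.
Arguments valid b%_nat_scope i%_ring_scope.

Lemma cong_lin b (x y x' y' : int) : cong b x y -> cong b x' y' ->
  cong b (x + x')%R (y + y')%R.
Proof.
rewrite /cong => h1 h2; have -> : (x + x' - (y + y') = x - y + (x' - y'))%R by ring.
exact: rpredD.
Qed.

Lemma cong_opp b (x y : int) : cong b x y -> cong b (- x)%R (- y)%R.
Proof.
by rewrite /cong => h; have -> : (- x - - y = - (x - y))%R by [ring]; rewrite rpredN.
Qed.

Lemma cong_sym b (x y : int) : cong b x y -> cong b y x.
Proof.
by rewrite /cong => h; have -> : (y - x = - (x - y))%R by [ring]; rewrite rpredN.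
Qed.

Lemma cong_refl b (x : int) : cong b x x.
Proof. by rewrite /cong subrr dvdz0. Qed.

Lemma cong_trans b (y x z : int) : cong b x y -> cong b y z -> cong b x z.
Proof.
rewrite /cong => h1 h2; have -> : (x - z = (x - y) + (y - z))%R by ring.
exact: rpredD.
Qed.

Lemma congP b (x y : int) :
  reflect (exists q : int, x = (y + q * (b - 1)%N%:Z)%R) (cong b x y).
Proof.
apply: (iffP dvdzP) => -[q E]; exists q; first by rewrite -E; ring.
by rewrite E; ring.
Qed.

Lemma cong_expn b m : 2 <= b -> cong b (b ^ m)%N%:Z 1.
Proof.
move=> hb; apply/congP; elim: m => [|m [q E]]; first by exists 0%R; rewrite mul0r addr0.
exists (q * b%:Z + 1)%R; rewrite expnS PoszM E.
by have -> : (b - 1)%N%:Z%R = (b%:Z - 1)%R by [lia]; ring.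
Qed.

Lemma valid_cong b i j : cong b i j -> valid b i -> valid b j.
Proof.
move=> /congP[q ->] /implyP h; apply/implyP => ob; have {h} := h ob.
rewrite [(b - 1)%N](_ : _ = 2 * (b./2))%N; last by move: ob; lia.
by rewrite PoszM mulrCA (rpredDr _ (dvdz_mulr _ (dvdzz _))).
Qed.

Lemma valid_F b u : 2 <= b -> 0 < F b u -> valid b u%:Z.
Proof.
move=> hb Fu; apply/implyP => ob; have := F_gt0_even hb ob Fu.
by rewrite -dvdn2.
Qed.

Lemma valid_sub_double b i m : valid b i -> valid b (i - 2 * m)%R.
Proof.
by move=> /implyP h; apply/implyP => ob; rewrite rpredBr ?h // dvdz_mulr.
Qed.

Lemma valid_compl b i : valid b i -> valid b (- i - 2)%R.
Proof.
by move=> /implyP h; apply/implyP => ob; rewrite rpredBr // rpredN h.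
Qed.

(* 2 is invertible modulo b - 1 for even b, with inverse b / 2; for odd b only
   the residue modulo (b - 1) / 2 of the half matters. *)
Lemma half_class b d : 2 <= b -> valid b d ->
  exists c : nat, [/\ 0 < c < b, odd b -> 2 * c <= b - 1 & cong b d (2 * c%:Z)%R].
Proof.
move=> hb vd.
have [e [k [k0 kb ok Hk]]] : exists (e : int) (k : nat),
    [/\ 0 < k, k < b, odd b -> 2 * k <= b - 1
      & forall x : int, (k%:Z %| (e - x)%R)%Z -> cong b d (2 * x)%R].
  case: (boolP (odd b)) => ob.
    move/implyP: vd => /(_ ob) /dvdzP[e Ee].
    exists e, (b./2); split; try by move: ob; lia.
    move=> x /dvdzP[q Eq]; apply/congP; exists q; rewrite Ee.
    rewrite [(b - 1)%N](_ : _ = 2 * (b./2))%N; last by move: ob; lia.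
    by rewrite PoszM mulrCA -Eq; ring.
  exists (d * (b./2)%:Z)%R, (b - 1); split; try lia.
  move=> x h; apply: (@cong_trans _ (d * b%:Z)%R).
    apply/congP; exists (- d)%R.
    by have -> : (b - 1)%N%:Z%R = (b%:Z - 1)%R by [lia]; ring.
  have -> : b%:Z%R = (2 * (b./2)%:Z)%R by move: ob; lia.
  move/dvdzP: h => [q Eq]; apply/congP; exists (2 * q)%R.
  by rewrite -mulrA -Eq; ring.
have kN : (k%:Z != 0)%R by lia.
(* Reducing [e - 1] and adding 1 back places the representative in [1..k] instead of [0..k-1]. *)
have r0 := modz_ge0 (e - 1)%R kN; have rk := ltz_mod (e - 1)%R kN.
have E := divz_eq (e - 1)%R k%:Z%R.
set r := ((e - 1) %% k%:Z)%Z in r0 rk E.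
exists `|r|.+1; split; [lia|move=> /ok; lia|].
apply: Hk; apply/dvdzP; exists ((e - 1) %/ k%:Z)%Z.
have -> : `|r|.+1%:Z%R = (r + 1)%R by lia.
lia.
Qed.

(** * Least elements, the minimum of [Kres'], and the choices [c] and [h] *)

Lemma leastP (P : pred nat) u : P u -> P (least P) /\ least P <= u.
Proof.
rewrite /least; case: pselect => [ex Pu|nex Pu]; last by case: nex; exists u.
by case: ex_minnP => m Pm hm; split=> //; apply: hm.
Qed.

Lemma Kres_spec b i n u : F b u = n -> cong b u%:Z i ->
  [/\ F b (Kres b i n) = n, cong b (Kres b i n)%:Z i & Kres b i n <= u].
Proof.
move=> Fu cu; rewrite /Kres; set P : pred nat := fun _ => _.
have [|/andP[/eqP h1 h2] h3] := @leastP P u; first by rewrite /P Fu eqxx eqz_mod_dvd.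
by split=> //; rewrite /cong -eqz_mod_dvd.
Qed.

Lemma Kres_cong b i j n : cong b i j -> Kres b i n = Kres b j n.
Proof.
move=> h; rewrite /Kres; congr least; apply: funext => u; congr (_ && _).
rewrite !eqz_mod_dvd; apply/idP/idP => h'; apply: cong_trans h' _ => //.
exact: cong_sym.
Qed.

Lemma Kres'_cong b i j n : cong b i j -> Kres' b i n = Kres' b j n.
Proof.
move=> h; have h' : cong b (- i - 2)%R (- j - 2)%R.
  by apply: cong_lin (cong_refl _ _); apply: cong_opp.
by rewrite /Kres' !(Kres_cong _ h) !(Kres_cong _ h').
Qed.

Lemma index_set_repr b i : 2 <= b -> valid b i ->
  exists2 j : 'I_(b - 1), j \in index_set b & cong b i (j : nat)%:Z.
Proof.
move=> hb vi; have bN : ((b - 1)%N%:Z != 0)%R by lia.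
have r0 := modz_ge0 i bN; have rb := ltz_mod i bN; have E := divz_eq i (b - 1)%N%:Z%R.
set r := (i %% (b - 1)%N)%Z in r0 rb E.
have rb' : `|r| < b - 1 by lia.
have ci : cong b i `|r|%:Z.
  apply/congP; exists (i %/ (b - 1)%N)%Z; have -> : `|r|%:Z%R = r by lia.
  by rewrite addrC.
exists (Ordinal rb') => //; rewrite inE /=; apply/implyP => ob.
by have /implyP/(_ ob) := valid_cong ci vi; rewrite -dvdn2.
Qed.

Lemma valid_index b (j : 'I_(b - 1)) : j \in index_set b -> valid b (j : nat)%:Z.
Proof.
rewrite inE => /implyP h; apply/implyP => /h; by rewrite -dvdn2.
Qed.

Lemma minKres'_le b i n : 2 <= b -> valid b i -> minKres' b n <= Kres' b i n.
Proof.
move=> hb /(index_set_repr hb)[j jI /(Kres'_cong n) ->].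
exact: (@bigmin_le_cond _ nat _ (Kres' b 0 n) j (mem (index_set b)) (fun j => Kres' b (j : nat)%:Z%R n)).
Qed.

Lemma minKres'_attained b n : exists2 i, valid b i & Kres' b i n = minKres' b n.
Proof.
rewrite /minKres'; apply: (big_ind (fun m => exists2 i, valid b i & Kres' b i n = m)).
- by exists 0%R => //; apply/implyP.
- by move=> x y hx hy; rewrite /minn; case: ifP.
- by move=> j /valid_index vj; exists (j : nat)%:Z%R.
Qed.

(** Halving [i - j], for a class [j] attaining the minimum, bounds [c]. The sharper bound for odd
    [b] serves the case of exponent 1. *)
Lemma c_spec b i n : 2 <= b -> valid b i ->
  [/\ 0 < c b i n < b, odd b -> 2 * c b i n <= b - 1,
      Kres' b (i - 2 * (c b i n)%:Z)%R n = minKres' b n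
    & forall m, 0 < m -> Kres' b (i - 2 * m%:Z)%R n = minKres' b n -> c b i n <= m].
Proof.
move=> hb vi; have [j vj Ej] := minKres'_attained b n.
have vij : valid b (i - j)%R.
  apply/implyP => ob; move/implyP: vi => /(_ ob); move/implyP: vj => /(_ ob) *.
  exact: rpredB.
have [m [m0 om hm]] := half_class hb vij.
set P : pred nat := fun m => (1 <= m) && (Kres' b (i - 2 * m%:Z)%R n == minKres' b n).
have Pm : P m.
  rewrite /P; have -> /= : 0 < m by lia.
  apply/eqP; rewrite -Ej; apply: Kres'_cong.
  have := cong_lin (cong_sym (cong_opp hm)) (cong_refl b i).
  have -> : (- (2 * m%:Z) + i = i - 2 * m%:Z)%R by ring.
  by have -> : (- (i - j) + i = j)%R by ring.
have [/andP[c0 /eqP cE] cm] := leastP Pm; rewrite -/(c b i n) in c0 cE cm.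
split=> //; [lia|by move=> /om; lia|].
by move=> m' m'0 E'; apply: (proj2 (leastP (P := P) _)); rewrite /P m'0 E' eqxx.
Qed.

(** Ensures that [Kres b i n] is a genuine minimum and not the default 0. *)
Definition attained b n := forall i, valid b i -> exists2 u, F b u = n & cong b u%:Z i.

Lemma attained_Kres b n i : attained b n -> valid b i ->
  F b (Kres b i n) = n /\ cong b (Kres b i n)%:Z i.
Proof. by move=> h /h[u Fu cu]; have [] := Kres_spec Fu cu. Qed.

Definition half_choice b i n :=
  if Kres b i (uphalf n) + Kres b (- i - 2)%R n./2
     < Kres b i n./2 + Kres b (- i - 2)%R (uphalf n)
  then uphalf n else n./2.

Lemma h_half_choice b i n : h b i n = half_choice b (i - 2 * (c b i n)%:Z)%R n.
Proof.
rewrite /h /half_choice; set m := (c b i n)%:Z%R.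
by have -> : (- (i - 2 * m) - 2 = 2 * m - i - 2)%R by ring.
Qed.

Lemma Kres'_half_choice b i n : 2 <= b -> valid b i ->
  attained b (uphalf n) -> attained b n./2 ->
  let w := Kres b i (half_choice b i n) in
  exists y, [/\ F b w + F b y = n, w + y = Kres' b i n, F b w = half_choice b i n,
    cong b w%:Z i & cong b y%:Z (- i - 2)%R].
Proof.
move=> hb vi ap aq w; have vi' := valid_compl vi.
exists (Kres b (- i - 2)%R (n - half_choice b i n)).
have ah : attained b (half_choice b i n) by rewrite /half_choice; case: ifP.
have ah' : attained b (n - half_choice b i n).
  rewrite /half_choice; case: ifP => _.
    by have -> : n - uphalf n = n./2 by lia.
  by have -> : n - n./2 = uphalf n by lia.
have [h1 h2] := attained_Kres ah vi; have [h3 h4] := attained_Kres ah' vi'.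
split=> //.
  by rewrite h1 h3 /half_choice; case: ifP => _; lia.
rewrite /w /Kres' /half_choice; case: ifP => h.
  by have -> : n - uphalf n = n./2 by [lia]; lia.
by have -> : n - n./2 = uphalf n by [lia]; lia.
Qed.

(** * Small arguments: the start of the induction *)

Lemma f_small b v : v < b -> f b v = 2 * v.
Proof. by move=> vb; rewrite /f digit_sum_small // mul2n addnn. Qed.

Lemma f_second b v : 2 <= b -> b <= v < 2 * b -> f b v + b = 2 * v + 1.
Proof.
move=> hb /andP[bv vb]; have [r Er] : exists r, v = 1 * b ^ 1 + r.
  by exists (v - b); rewrite expn1; lia.
have rb : r < b ^ 1 by rewrite expn1 in Er *; lia.
rewrite /f Er digit_sum_split //; rewrite expn1 in rb *.
by rewrite digit_sum_small //; lia.
Qed.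

Lemma F_gt0P b u : reflect (exists2 v, v <= u & f b v = u) (0 < F b u).
Proof.
apply: (iffP card_gt0P) => [[v]|[v vu fv]].
  by rewrite inE => /eqP fv; exists v => //; have := ltn_ord v; lia.
by exists (inord v); rewrite inE inordK ?fv.
Qed.

Lemma F_small_even b u : u < b -> 0 < F b u -> ~~ odd u.
Proof.
by move=> ub /F_gt0P[v vu]; rewrite f_small; [lia|apply: leq_ltn_trans ub].
Qed.

(* The least u with F b u = 2 is b + 1 for odd b and b ^ 2 + 1 for even b, but the
   cruder bound for even b is enough to start the induction. *)
Lemma F_small_le1 b u : 2 <= b -> u < (if odd b then b + 1 else 2 * b) -> F b u <= 1.
Proof.
move=> hb; case: ifP => ob ub.
  have [->|ub'] : u = b \/ u < b by lia.
    by case: (posnP (F b b)) => [->//|/(F_gt0_even hb ob)]; rewrite ob.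
  apply/card_le1_eqP => v v'; rewrite !inE => /eqP fv /eqP fv'; apply: val_inj => /=.
  move: fv fv'; rewrite !f_small; try lia.
    by have := ltn_ord v'; lia.
  by have := ltn_ord v; lia.
apply/card_le1_eqP => v v'; rewrite !inE => /eqP fv /eqP fv'; apply: val_inj => /=.
have := ltn_ord v; have := ltn_ord v'; move: fv fv'.
have D (t : nat) : t < 2 * b -> f b t = 2 * t /\ t < b \/ f b t + b = 2 * t + 1 /\ b <= t.
  case: (ltnP t b) => tb tb2; first by left; rewrite f_small.
  by right; split=> //; apply: f_second => //; rewrite tb.
move=> fv fv' vu' vu; have := D v; have := D v'; lia.
Qed.

(** The witness is [f b c = 2 * c] for a one-digit [c] from [half_class]; [F_small_le1] covers
    everything up to [2 * c + 1]. *)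
Lemma Kres1_bound b i : 2 <= b -> valid b i ->
  exists u, [/\ F b u = 1, cong b u%:Z i & forall t, F b t = 2 -> u + 2 <= t].
Proof.
move=> hb vi; have [c [c0 oc hc]] := half_class hb vi.
exists (2 * c); split; last first.
- move=> t Ft; rewrite leqNgt; apply/negP => tu.
  suff : F b t <= 1 by rewrite Ft.
  by apply: F_small_le1 => //; case: ifP => ob; [have := oc ob|]; lia.
- by apply: cong_sym; rewrite PoszM.
apply/eqP; rewrite eqn_leq F_small_le1 //=; last first.
  by case: ifP => ob; [have := oc ob|]; lia.
by apply/F_gt0P; exists c; [|rewrite f_small]; lia.
Qed.

(** * Size, residue and cost of a split *)

Lemma expn_ge_linear b m : 2 <= b -> 2 <= m -> (b - 1) * m.+1 <= b ^ m.
Proof.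
move=> hb; elim: m => // m IH; rewrite leq_eqVlt => /predU1P[<-|m2].
  by rewrite -mulnn; nia.
have := IH m2; rewrite expnS (mulnS _ m.+1); move: (b ^ m) => X; nia.
Qed.

(** For [2 <= m], [expn_ge_linear] leaves room even for [c = b - 1]; for [m = 1] the room comes from
    the bound on [2 * c]. *)
Lemma block_lt_expn b m c w : 2 <= b -> 0 < m -> c < b -> w + 2 <= (b - 1) * m ->
  (m = 1 -> 2 * c <= b - 1) -> c * (b ^ m + 1) + w < b ^ m.+1.
Proof.
move=> hb m0 cb wm c1; have [m1|m2] : m = 1 \/ 2 <= m by lia.
  by subst m; have := c1 erefl; rewrite muln1 in wm; rewrite -mulnn expn1; nia.
have := expn_ge_linear hb m2; rewrite mulnS expnS.
move: (b ^ m) ((b - 1) * m) wm => X Y wm h; have : c * (X + 1) <= (b - 1) * (X + 1).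
  by rewrite leq_mul2r; apply/orP; right; lia.
have E : (b - 1) * (X + 1) + X + 1 = b * X + b by nia.
lia.
Qed.

(** As [b ^ m] is 1 modulo [b - 1], each unit of [c] shifts the class by 2; hence the subscripts
    [i - 2c]. *)
Lemma cong_block b m c w : 2 <= b ->
  cong b (c * (b ^ m + 1) + w)%N%:Z (2 * c%:Z + w%:Z).
Proof.
move=> hb; have /congP[q E] := cong_expn m hb; apply/congP; exists (c%:Z * q)%R.
by rewrite PoszD PoszM PoszD E; ring.
Qed.

Lemma cong_total b m x y : 2 <= b -> x + y + 2 = (b - 1) * m ->
  cong b (x + y)%N%:Z (- 2).
Proof.
move=> hb E; apply/congP; exists m%:Z%R.
have := congr1 Posz E; rewrite PoszM PoszD; lia.
Qed.

Lemma Kres'_le_add b n j x y : cong b x%:Z j -> cong b (x + y)%N%:Z (- 2) ->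
  F b x + F b y = n -> (F b x == uphalf n) || (F b x == n./2) ->
  Kres' b j n <= x + y.
Proof.
move=> cx cxy Fxy Fx.
have cy : cong b y%:Z (- j - 2).
  have := cong_lin cxy (cong_opp cx).
  have -> : ((x + y)%N%:Z + - x%:Z = y%:Z)%R by rewrite PoszD; ring.
  by rewrite addrC.
case/orP: Fx => /eqP Fx.
  have Fy : F b y = n./2 by lia.
  have [_ _ h1] := Kres_spec Fx cx; have [_ _ h2] := Kres_spec Fy cy.
  by rewrite /Kres'; lia.
have Fy : F b y = uphalf n by lia.
have [_ _ h1] := Kres_spec Fx cx; have [_ _ h2] := Kres_spec Fy cy.
by rewrite /Kres'; lia.
Qed.

Lemma minKres'_le_add b n x y : 2 <= b -> 2 <= n -> cong b (x + y)%N%:Z (- 2) ->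
  F b x + F b y = n -> (F b x == uphalf n) || (F b x == n./2) ->
  minKres' b n <= x + y.
Proof.
move=> hb hn cxy Fxy Fx; have vx : valid b x%:Z by apply: valid_F => //; lia.
exact: leq_trans (minKres'_le n hb vx) (Kres'_le_add (cong_refl _ _) cxy Fxy Fx).
Qed.

(** On a tie [half_choice] takes [n./2], whose least element is no larger; if it takes [uphalf n],
    the strict inequality rules out the other split. *)
Lemma half_choice_min b n j x y :
  Kres b j n./2 <= Kres b j (uphalf n) ->
  cong b x%:Z j -> cong b (x + y)%N%:Z (- 2) -> F b x + F b y = n ->
  (F b x == uphalf n) || (F b x == n./2) -> x + y = Kres' b j n ->
  Kres b j (half_choice b j n) <= x.
Proof.
move=> mono cx cxy Fxy Fx Exy.
have cy : cong b y%:Z (- j - 2).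
  have := cong_lin cxy (cong_opp cx).
  have -> : ((x + y)%N%:Z + - x%:Z = y%:Z)%R by rewrite PoszD; ring.
  by rewrite addrC.
move: Exy; rewrite /half_choice /Kres'; case/orP: Fx => /eqP Fx.
  by have [_ _ h1] := Kres_spec Fx cx; case: ifP => //; lia.
have Fy : F b y = uphalf n by lia.
have [_ _ h1] := Kres_spec Fx cx; have [_ _ h2] := Kres_spec Fy cy.
by case: ifP => //; lia.
Qed.

Lemma K_spec b n u : F b u = n -> F b (K b n) = n /\ K b n <= u.
Proof.
move=> Fu; have [|/eqP h1 h2] := @leastP (fun u => F b u == n) u; first by rewrite Fu.
by [].
Qed.

(** * The inductive statement and its step *)

(** What the induction carries. [structure_B1] excludes exponent 1 for even [b], where [c] has no
    bound by [(b - 1) / 2]. *)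
Record structure b n : Prop := Structure {
  structure_B : (b - 1) * B b n = minKres' b n + 2;
  structure_B1 : B b n = 1 -> odd b;
  structure_low : forall u, F b u = n -> b ^ B b n <= u;
  structure_K : forall i, valid b i ->
    let ci := c b i n in
    let w := Kres b (i - 2 * ci%:Z)%R (h b i n) in
    [/\ Kres b i n = ci * (b ^ B b n + 1) + w,
        w + 2 <= (b - 1) * B b n,
        F b (Kres b i n) = n, cong b (Kres b i n)%:Z i
      & Kres b i n < b ^ (B b n).+1] }.

(** The last premise says that cheap splits are balanced. Joining a minimal pair bounds [B b n]
    above, splitting [K b n] bounds it below. *)
Lemma structure_step b n : 2 <= b -> 2 <= n ->
  attained b (uphalf n) -> attained b n./2 ->
  (forall i, valid b i -> Kres b i n./2 <= Kres b i (uphalf n)) ->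
  (forall x y, F b x + F b y = n -> F b x < n -> F b y < n ->
     cong b (x + y)%N%:Z (- 2) -> x + y <= minKres' b n ->
     (F b x == uphalf n) || (F b x == n./2)) ->
  structure b n.
Proof.
move=> hb hn ap aq mono unb.
have pair i : valid b i -> Kres' b i n = minKres' b n ->
    let w := Kres b i (half_choice b i n) in
    exists y, [/\ F b w + F b y = n, w + y = minKres' b n,
      0 < F b w, 0 < F b y & cong b w%:Z i /\ cong b (w + y)%N%:Z (- 2)].
  move=> vi Ei w; have [y [h1 h2 h3 h4 h5]] := Kres'_half_choice hb vi ap aq.
  have hc : half_choice b i n = uphalf n \/ half_choice b i n = n./2.
    by rewrite /half_choice; case: ifP; [left|right].
  exists y; split=> //; [by rewrite h2|rewrite h3; lia|lia|split=> //].
  by have := cong_lin h4 h5; have -> : (i + (- i - 2) = - 2)%R by ring.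
have [j0 vj0 Ej0] := minKres'_attained b n.
have [y0 [Fn0 E0 Fw0 Fy0 [_ cong0]]] := pair _ vj0 Ej0.
set w0 := Kres b j0 _ in Fn0 E0 Fw0 Fy0 cong0.
(* The minimal sum lies in the class of -2; this [m] will turn out to be [B b n]. *)
have [m Em] : exists m, minKres' b n + 2 = (b - 1) * m.
  have : (b - 1 %| minKres' b n + 2)%N.
    by move: cong0; rewrite E0 /cong opprK.
  by case/dvdnP => m Em; exists m; rewrite mulnC.
have m0 : 0 < m by case: (posnP m) Em => // ->; lia.
(* For even [b] and [m = 1], [w0] and [y0] would be even, being below [b], while their sum [b - 3]
   is odd. *)
have m1 : m = 1 -> odd b.
  move=> m1; rewrite m1 muln1 in Em; apply/negPn/negP => eb.
  have := @F_small_even b w0; have := @F_small_even b y0; lia.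
have U i : valid b i -> let j := (i - 2 * (c b i n)%:Z)%R in
    let w := Kres b j (half_choice b j n) in
    [/\ w + 2 <= (b - 1) * m, F b (c b i n * (b ^ m + 1) + w) = n,
     cong b (c b i n * (b ^ m + 1) + w)%N%:Z i &
     c b i n * (b ^ m + 1) + w < b ^ m.+1].
  move=> vi j w; have [c0 oc Ec _] := c_spec n hb vi.
  have [y [h1 h2 h3 h4 [h5 h6]]] := pair _ (valid_sub_double _ vi) Ec.
  rewrite -/j -/w in h1 h2 h3 h5 h6.
  have wm : w + 2 <= (b - 1) * m by lia.
  have lt : c b i n * (b ^ m + 1) + w < b ^ m.+1.
    by apply: block_lt_expn => //; [lia|move=> /m1].
  split=> //; first by rewrite (F_join (y := y)) // -Em h2.
  apply: cong_trans (cong_block _ _ _ hb) _.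
  have := cong_lin (cong_refl b (2 * (c b i n)%:Z)) h5.
  by have -> : (2 * (c b i n)%:Z + j = i)%R by [rewrite /j; ring].
have [_ FU _ ltU] := U _ vj0; have [FK K_le] := K_spec FU.
have K0 : 0 < K b n.
  by have := max_card [set v : 'I_(K b n).+1 | f b v == K b n]; rewrite -/(F b _) FK card_ord; lia.
have /andP[BK KB] := trunc_log_bounds hb K0; rewrite -/(B b n) in BK KB.
have low u : F b u = n -> b ^ B b n <= u.
  by move=> Fu; apply: leq_trans BK _; have [] := K_spec Fu.
have Bm : B b n <= m.
  rewrite -ltnS -(@ltn_exp2l b) //; exact: leq_ltn_trans BK (leq_ltn_trans K_le ltU).
(* No number below [b ^ B b n] has exactly [n] preimages, so both parts of a split have strictly
   fewer. *)
have lt_n k x : F b x <= n -> x < b ^ k -> k <= B b n -> F b x < n.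
  rewrite leq_eqVlt => /predU1P[/low Fx|//] xk kB.
  by have := leq_trans xk (leq_trans (leq_pexp2l (ltnW hb) kB) Fx); rewrite ltnn.
have split u : b ^ B b n <= u < b ^ (B b n).+1 -> F b u = n ->
    exists c w y, [/\ 0 < c < b, w + y + 2 = (b - 1) * B b n,
      u = c * (b ^ B b n + 1) + w & [/\ F b w + F b y = n,
     cong b (w + y)%N%:Z (- 2) & (F b w == uphalf n) || (F b w == n./2)]].
  move=> hu Fu; have Fu0 : 0 < F b u by lia.
  have [[x xB Fx]|[c' [w [y [h1 h2 h3 h4]]]]] := F_split hb hu Fu0.
    by have := low x; rewrite Fx Fu => /(_ erefl); lia.
  have L := expn_gt_linear (B b n) hb; have cwy := cong_total hb h2.
  exists c', w, y; split=> //; split; [lia|by []|].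
  apply: (unb w y) => //; [lia| | |].
  - by apply: (lt_n (B b n)); lia.
  - by apply: (lt_n (B b n)); lia.
  have : (b - 1) * B b n <= (b - 1) * m by rewrite leq_mul2l Bm orbT.
  lia.
have {Bm} EB : B b n = m.
  have hK : b ^ B b n <= K b n < b ^ (B b n).+1 by rewrite BK.
  have [c' [w [y [_ h2 _ [h4 h5 h6]]]]] := split _ hK FK.
  have := minKres'_le_add hb hn h5 h4 h6.
  have [|Blt] : B b n = m \/ B b n < m by lia.
    by [].
  have : (b - 1) * (B b n).+1 <= (b - 1) * m by rewrite leq_mul2l Blt orbT.
  rewrite mulnS; lia.
constructor; rewrite ?EB //; first by rewrite -EB.
move=> i vi ci w; rewrite /w h_half_choice -/ci {w}.
have [wm FU' cU ltU'] := U _ vi; rewrite -/ci in wm FU' cU ltU'.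
set j := (i - 2 * ci%:Z)%R in wm FU' cU ltU' *.
set w := Kres b j _ in wm FU' cU ltU' *.
have [FKi cKi Ki_le] := Kres_spec FU' cU.
have hKi : b ^ B b n <= Kres b i n < b ^ (B b n).+1.
  by rewrite low //= EB; apply: leq_ltn_trans Ki_le ltU'.
split=> //; last by rewrite -EB; case/andP: hKi.
have [c' [w' [y' [c'b h2 h3 [h4 h5 h6]]]]] := split _ hKi FKi.
rewrite EB in h2 h3.
have wy : w' + y' = minKres' b n by lia.
have cw' : cong b w'%:Z (i - 2 * c'%:Z).
  have /congP[q Eq] := cong_block m c' w' hb; rewrite -h3 in Eq.
  have := cong_lin cKi (cong_refl b (- (2 * c'%:Z))); rewrite Eq => cc.
  apply: cong_trans cc; apply/congP; exists (- q)%R; ring.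
have [c0 _ Ec cmin] := c_spec n hb vi; rewrite -/ci in c0 Ec cmin.
have cc' : ci <= c'.
  apply: cmin; first by case/andP: c'b.
  apply/eqP; rewrite eqn_leq -{1}wy (Kres'_le_add cw' h5 h4 h6) /=.
  exact: minKres'_le (valid_sub_double _ vi).
(* A larger [c'] would cost an extra [b ^ m + 1], more than the whole remainder [w] of the
   candidate. *)
have Ec' : c' = ci.
  apply/eqP; rewrite eqn_leq cc' andbT leqNgt; apply/negP => lt.
  have : ci.+1 * (b ^ m + 1) <= c' * (b ^ m + 1) by rewrite leq_mul2r lt orbT.
  have := expn_gt_linear m hb; rewrite mulSn; lia.
suff : w <= w' by rewrite Ec' in h3; lia.
rewrite Ec' in cw'; apply: (half_choice_min _ cw' h5 h4 h6).
  exact: mono (valid_sub_double _ vi).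
by rewrite wy Ec.
Qed.

(** * Growth in [n] and cheap pairs *)

(** From [n] to [n + 1] one half [n./2] becomes [n./2.+1], so each sum competing at [n + 1] exceeds
    one competing at [n] by at least 2. *)
Lemma minKres'_incr b n : 2 <= b ->
  (forall i, valid b i -> Kres b i n./2 + 2 <= Kres b i n./2.+1) ->
  minKres' b n + 2 <= minKres' b n.+1.
Proof.
move=> hb mono; have [j vj <-] := minKres'_attained b n.+1.
apply: (@leq_trans (Kres' b j n + 2)); first by rewrite leq_add2r minKres'_le.
have := mono _ vj; have := mono _ (valid_compl vj); rewrite /Kres'.
case: (boolP (odd n)) => on.
  have -> : uphalf n = n./2.+1 by lia.
  have -> : uphalf n.+1 = n./2.+1 by lia.
  by have -> : n.+1./2 = n./2.+1 by [lia]; lia.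
have -> : uphalf n = n./2 by lia.
have -> : uphalf n.+1 = n./2.+1 by lia.
by have -> : n.+1./2 = n./2 by [lia]; lia.
Qed.

(** By [structure_B], the growth of the minimum is [b - 1] times that of [B]. The gain of 2 for
    [b = 2] matches the bound in [structure_pair]. *)
Lemma structure_B_incr b n : 2 <= b -> structure b n -> structure b n.+1 ->
  minKres' b n + 2 <= minKres' b n.+1 ->
  B b n + (if b == 2 then 2 else 1) <= B b n.+1.
Proof.
move=> hb Sn Sn1 hM; have := structure_B Sn; have := structure_B Sn1.
case: eqP hM => [->|_] hM E1 E0; first lia.
have b0 : 0 < b - 1 by lia.
by rewrite addn1 -(ltn_pmul2l b0); lia.
Qed.

(** [Kres b i n] is below [b ^ B b n.+1], while [Kres b i n.+1] is at least [b ^ B b n.+1 + 1]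
    because [c] is positive. *)
Lemma structure_Kres_incr b n i : 2 <= b -> structure b n -> structure b n.+1 ->
  minKres' b n + 2 <= minKres' b n.+1 -> valid b i ->
  Kres b i n + 2 <= Kres b i n.+1.
Proof.
move=> hb Sn Sn1 hM vi; have Blt : B b n < B b n.+1.
  by have := structure_B_incr hb Sn Sn1 hM; case: eqP; lia.
have [_ _ _ _ lt] := structure_K Sn vi; have [-> _ _ _ _] := structure_K Sn1 vi.
have [c0 _ _ _] := c_spec n.+1 hb vi.
have := leq_pexp2l (ltnW hb) Blt; move: c0; case: (c b i n.+1) => // c' _.
rewrite mulSn; lia.
Qed.

(* Writing the minimal sum M(n) as w + y, the two numbers are c (b^B(n) + 1) + w
   and c' (b^B(n) + 1) + y, where b - 1 divides 2 (c + c') and c + c' is so small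
   that their sum stays below b^(B(n) + 1) (below b^(B(n) + 2) if b = 2). *)
Lemma structure_pair b n : 2 <= b -> 2 <= n -> structure b n ->
  attained b (uphalf n) -> attained b n./2 ->
  exists x y, [/\ F b x = n, F b y = n, cong b (x + y)%N%:Z (- 2)
    & x + y < b ^ (B b n + (if b == 2 then 2 else 1))].
Proof.
move=> hb hn Sn ap aq; have [j vj Ej] := minKres'_attained b n.
have [y [Fn E _ h4 h5]] := Kres'_half_choice hb vj ap aq.
move: Fn E h4; set w := Kres b j _ => Fn E h4.
have EB := structure_B Sn; have B1 := structure_B1 Sn.
rewrite -Ej -E in EB; move: (B b n) EB B1 => m EB B1.
have m0 : 0 < m by case: (posnP m) EB => // ->; lia.
have [c1 [c2 [/andP[c10 c1b] /andP[c20 c2b] hc1 hc2 [hs hlt]]]] :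
    exists c1 c2, [/\ 0 < c1 < b, 0 < c2 < b, m = 1 -> 2 * c1 <= b - 1,
       m = 1 -> 2 * c2 <= b - 1 & cong b (2 * (c1 + c2)%N%:Z) 0 /\
       (c1 + c2) * (b ^ m + 1) + (w + y) < b ^ (m + (if b == 2 then 2 else 1))].
  have [b2|b3] : b = 2 \/ 3 <= b by lia.
    have mN1 : m <> 1 by move/B1; rewrite b2.
    exists 1, 1; rewrite b2 /=; split=> //; split; first exact: dvd1z.
    have -> : 2 ^ (m + 2) = 4 * 2 ^ m by rewrite expnD mulnC.
    have := expn_gt_linear m (leqnn 2); rewrite b2 in EB; lia.
  have -> : (b == 2) = false by lia.
  rewrite (addn1 m); have [m1|m2] : m = 1 \/ 2 <= m by lia.
    have ob := B1 m1; rewrite m1 muln1 in EB; rewrite m1 -mulnn expn1.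
    have [b3'|b5] : b = 3 \/ 5 <= b by move: ob; lia.
      by exists 1, 1; rewrite b3' in EB *; split=> //; split=> //; lia.
    (* The coefficients 1 and [k.+1] add up to [(b - 1) / 2]; for exponent 1 the sum [b - 1] would
       be too large. *)
    have [k Ek] : exists k, b = 2 * k + 5 by exists ((b - 5)./2); move: ob; lia.
    exists 1, k.+1; split; try lia; split.
      apply/congP; exists 1%R; rewrite Ek; lia.
    by rewrite Ek in EB *; nia.
  exists 1, (b - 2); split; try lia.
  have -> : 1 + (b - 2) = b - 1 by lia.
  split; first by apply/congP; exists 2%R; ring.
  have := expn_ge_linear hb m2; rewrite mulnS expnS EB.
  move: (b ^ m) => X h; have : (b - 1) * (X + 1) + X + 1 = b * X + b by nia.
  by move: h; lia.
exists (c1 * (b ^ m + 1) + w), (c2 * (b ^ m + 1) + y); split.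
- by rewrite (F_join (y := y)) ?c10 //; apply: block_lt_expn => //; lia.
- rewrite (F_join (y := w)) ?c20 //; [lia|lia|apply: block_lt_expn => //; lia].
- have := cong_lin (cong_lin (cong_block m c1 w hb) (cong_block m c2 y hb)) (cong_refl b 0).
  rewrite addr0 -PoszD => /cong_trans; apply.
  have := cong_lin hs (cong_lin h4 h5); have -> : (0 + (j + (- j - 2)) = - 2)%R by ring.
  by have -> : (2 * (c1 + c2)%N%:Z + (w%:Z + y%:Z) =
    2 * c1%:Z + w%:Z + (2 * c2%:Z + y%:Z) + 0)%R by [rewrite PoszD; ring].
by apply: leq_ltn_trans hlt; rewrite mulnDl; lia.
Qed.

(** * The strong induction and the conclusion *)

Lemma structureP b n : 2 <= b -> 2 <= n ->
  structure b n /\ forall i, valid b i -> Kres b i n.-1 + 2 <= Kres b i n.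
Proof.
move=> hb; elim/ltn_ind: n => n IH hn.
have att k : 1 <= k < n -> attained b k.
  case/andP=> k1 kn i vi; case: (ltnP 1 k) => k2.
    have [_ _ FK cK _] := structure_K (proj1 (IH k kn k2)) vi.
    by exists (Kres b i k).
  have -> : k = 1 by lia.
  by have [u [Fu cu _]] := Kres1_bound hb vi; exists u.
have mono k i : 1 <= k -> k.+1 < n -> valid b i -> Kres b i k + 2 <= Kres b i k.+1.
  by move=> k1 kn vi; apply: (proj2 (IH k.+1 kn _)).
have mono_le k k' i : 1 <= k -> k <= k' -> k' < n -> valid b i ->
    Kres b i k <= Kres b i k'.
  move=> k1 + + vi; elim: k' => [|k' IHk]; first lia.
  rewrite leq_eqVlt => /predU1P[->//|kk'] k'n.
  have := IHk kk' (ltnW k'n); have := @mono k' i; move/(_ _ k'n vi); lia.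
have incrM k : 2 <= k -> k < n -> minKres' b k + 2 <= minKres' b k.+1.
  by move=> k2 kn; apply: minKres'_incr => // i vi; apply: mono => //; lia.
have ap : attained b (uphalf n) by apply: att; lia.
have aq : attained b n./2 by apply: att; lia.
have halves i : valid b i -> Kres b i n./2 <= Kres b i (uphalf n).
  by move=> vi; apply: mono_le => //; lia.
(* Replacing [u2], with [p = uphalf n] preimages, by the least number of its class with [n./2] gives
   a balanced split of sum at most [u1 + u2], which is below [b ^ B b p.+1] and hence below [x]. *)
have large x : uphalf n < F b x < n -> minKres' b n < x.
  move=> /andP[px xn]; set p := uphalf n in px ap halves.
  have p2 : 2 <= p by rewrite /p; lia.
  have Sp : structure b p by apply: (proj1 (IH _ _ _)) => //; lia.
  have Sp1 : structure b p.+1 by apply: (proj1 (IH _ _ _)) => //; lia.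
  have [u1 [u2 [Fu1 Fu2 cu lt]]] : exists x y, [/\ F b x = p, F b y = p,
      cong b (x + y)%N%:Z (- 2) & x + y < b ^ (B b p + (if b == 2 then 2 else 1))].
    by apply: structure_pair => //; apply: att; lia.
  have vu2 : valid b u2%:Z by apply: valid_F => //; lia.
  have [_ _ le2] := Kres_spec Fu2 (cong_refl b u2%:Z).
  have [Fy cy] := attained_Kres aq vu2.
  have hle := halves _ vu2.
  have Mle : minKres' b n <= u1 + Kres b u2%:Z%R n./2.
    apply: minKres'_le_add => //; [|lia|by rewrite Fu1 eqxx].
    apply: cong_trans cu; rewrite !PoszD; apply: cong_lin cy; exact: cong_refl.
  have BB := structure_B_incr hb Sp Sp1 (incrM p p2 _).
  have vx : valid b x%:Z by apply: valid_F => //; lia.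
  have [_ _ lex] := Kres_spec (erefl (F b x)) (cong_refl b x%:Z).
  have lex1 : Kres b x%:Z%R p.+1 <= x by apply: leq_trans lex; apply: mono_le => //; lia.
  have [_ _ FK1 _ _] := structure_K Sp1 vx.
  have := structure_low Sp1 FK1.
  have := leq_pexp2l (ltnW hb) (BB ltac:(lia)).
  lia.
have Sn : structure b n.
  apply: structure_step => // x y Fxy xn yn _ le.
  apply/negPn/negP => /norP[xp xq].
  have [xl|yl] : uphalf n < F b x \/ uphalf n < F b y by lia.
    by have := large x; rewrite xl xn => /(_ erefl); lia.
  by have := large y; rewrite yl yn => /(_ erefl); lia.
(* For [n = 2] the predecessor 1 has no [structure], so [Kres1_bound] gives the gap. *)
split=> // i vi; have [n2|n3] : n = 2 \/ 2 < n by lia.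
  have [u [Fu cu hu]] := Kres1_bound hb vi.
  have [_ _ le] := Kres_spec Fu cu; have [_ _ FK _ _] := structure_K Sn vi.
  by rewrite n2 in FK * => /=; have := hu _ FK; lia.
case: n hn n3 IH att mono mono_le incrM ap aq halves large Sn => // k _ k2 IH _ _ _ incrM _ _ _ _ Sn.
apply: structure_Kres_incr => //; last exact: incrM.
by apply: (proj1 (IH _ _ _)).
Qed.

Theorem theorem6p3 (b : nat) (i : 'I_(b - 1)) (n : nat)
    (hb : 2 <= b) (hi : i \in index_set b) (hn : 2 <= n) :
  let ci := c b i n in
  let w := Kres b (i%:Z - 2 * ci%:Z)%R (h b i n) in
  [/\ Kres b i n = ci * (b ^ B b n + 1) + w,
      1 <= ci <= b - 1
    & (0 <= w%:Z <= (b%:Z - 1) * (B b n)%:Z - 2)%R].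
Proof.
move=> ci w; have vi := valid_index hi; have [Sn _] := structureP hb hn.
have [h1 h2 _ _ _] := structure_K Sn vi; have [c0 _ _ _] := c_spec n hb vi.
split=> //; first by rewrite -/ci in c0; lia.
have := congr1 Posz (subnK h2); rewrite !PoszD PoszM -/ci -/w.
have -> : (b - 1)%N%:Z%R = (b%:Z - 1)%R by lia.
lia.
Qed.
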